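(* Let $M$ be a matroid on an $n$-element ground set $E$, let $\mathbb{k}$ be any field, and for each integer $l$ let $\beta^{(l)}_{i,j}$ denote the $\mathbb{N}$-graded Betti numbers of the Stanley–Reisner ideal $I_{M_l}$ of the elongation $M_l$, with the convention $\beta^{(l)}_{i,j}=0$ whenever $l\notin[0,n-r(M)]$. Then for each $1\le j\le n$ and each integer $l\ge 0$, the coefficient of $Z^l$ in the generalized weight polynomial $P_{M,j}(Z)$ is equal to \[\sum_{i=0}^{n}(-1)^{i}\Big(\beta^{(l-1)}_{i,j}-\beta^{(l)}_{i,j}\Big).\]
   Context: For a matroid $M$ on a finite set $E$ with rank function $r=r_M$, the nullity of $\sigma\subseteq E$ is $n_M(\sigma)=|\sigma|-r_M(\sigma)$, and $r(M)=r_M(E)$. For $0\le l\le |E|-r(M)$, the elongation $M_l$ is the matroid on $E$ whose independent sets are $\{\sigma\subseteq E: n_M(\sigma)\le l\}$; so $M_0=M$. Generalized weight polynomials: $P_{M,0}(Z)=1$ and, for $1\le j\le |E|$, $P_{M,j}(Z)=(-1)^j\sum_{\sigma\subseteq E,\,|\sigma|=j}\sum_{\gamma\subseteq\sigma}(-1)^{|\gamma|}Z^{n_M(\gamma)}$. Write $E=\{e_1,\dots,e_n\}$ and $S=\mathbb{k}[x_1,\dots,x_n]$. A circuit of a matroid is a minimal dependent subset. The Stanley–Reisner ideal $I_N$ of a matroid $N$ on $E$ is the ideal of $S$ generated by the monomials $x_{j_1}\cdots x_{j_s}$ for which $\{e_{j_1},\dots,e_{j_s}\}$ is a circuit of $N$.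 Its $\mathbb{N}$-graded Betti numbers $\beta_{i,j}$ are defined by a minimal graded free resolution $0\leftarrow F_0\leftarrow F_1\leftarrow\cdots$ of $I_N$ (with $F_0\to I_N$ surjective), $F_i=\bigoplus_j S(-j)^{\beta_{i,j}}$; equivalently $\beta_{i,j}=\dim_{\mathbb{k}}\operatorname{Tor}_i^S(I_N,\mathbb{k})_j$. For matroids these numbers do not depend on the field $\mathbb{k}$. *)

(* Defs.v *)
From HB Require Import structures.
From mathcomp Require Import all_boot all_order all_algebra.
From mathcomp Require Import mpoly zify.

Set Implicit Arguments.
Unset Strict Implicit.
Unset Printing Implicit Defensive.

Import GRing.Theory.
Local Open Scope ring_scope.

Record matroid (E : finType) := Matroid {
  indep : {set {set E}};
  indep0 : set0 \in indep;
  indepS : forall A B : {set E}, A \subset B -> B \in indep -> A \in indep;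
  indep_aug : forall A B : {set E}, A \in indep -> B \in indep ->
    (#|A| < #|B|)%N -> exists2 x, x \in B :\: A & x |: A \in indep
}.

Section Matroids.
Variables (E : finType) (M : matroid E).
Implicit Types (A B C : {set E}) (l j : nat).

Definition mrank A : nat := \max_(B in indep M | B \subset A) #|B|.

(* The subtraction never truncates, by mrank_le_card below. *)
Definition nullity A : nat := (#|A| - mrank A)%N.

Definition circuit C : bool := minset (fun A => A \notin indep M) C.

Lemma leq_mrank A B : B \in indep M -> B \subset A -> (#|B| <= mrank A)%N.
Proof.
move=> iB sBA.
by apply: (@leq_bigmax_cond _ _ (fun B : {set E} => #|B|) B); rewrite iB.
Qed.

Lemma mrankP A : exists B, [/\ B \in indep M, B \subset A & #|B| = mrank A].
Proof.
have nz : (0 < #|[pred B | (B \in indep M) && (B \subset A)]|)%N.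
  by apply/card_gt0P; exists set0; rewrite inE /= indep0 sub0set.
have [B /andP[iB sBA] e] := eq_bigmax_cond (fun B : {set E} => #|B|) nz.
by exists B; split=> //; rewrite -e.
Qed.

Lemma mrank_le_card A : (mrank A <= #|A|)%N.
Proof. by apply/bigmax_leqP=> B /andP[_ /subset_leq_card]. Qed.

Lemma mrankS A B : A \subset B -> (mrank A <= mrank B)%N.
Proof.
move=> sAB; apply/bigmax_leqP=> C /andP[iC sCA].
exact: leq_mrank iC (subset_trans sCA sAB).
Qed.

Lemma mrank_leD A B : A \subset B -> (mrank B <= mrank A + #|B :\: A|)%N.
Proof.
move=> sAB; have [C [iC sC <-]] := mrankP B.
rewrite -(cardsID A C) leq_add ?subset_leq_card ?setSD //.
by apply: leq_mrank (subsetIr _ _); apply: indepS (subsetIl _ _) iC.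
Qed.

Lemma mrank_aug A B : (mrank A < mrank B)%N ->
  exists2 x, x \in B :\: A & (mrank A < mrank (x |: A))%N.
Proof.
have [A' [iA sA eA]] := mrankP A; have [B' [iB sB eB]] := mrankP B.
rewrite -{1}eA -eB => lt; have [x /setDP[xB xA] ix] := indep_aug iA iB lt.
have lt' : (mrank A < #|x |: A'|)%N by rewrite cardsU1 xA -eA.
exists x; last exact: leq_trans lt' (leq_mrank ix (setUS _ sA)).
rewrite inE (subsetP sB _ xB) andbT; apply/negP=> xA'.
have sxA : x |: A' \subset A by rewrite subUset sub1set xA'.
by have := leq_mrank ix sxA; rewrite leqNgt lt'.
Qed.

Lemma nullityS A B : A \subset B -> (nullity A <= nullity B)%N.
Proof.
move=> sAB; have := mrank_leD sAB; have := mrank_le_card A.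
have := mrank_le_card B; have := cardsD B A.
have := subset_leq_card sAB; rewrite (setIidPr sAB) /nullity; lia.
Qed.

Definition elongation_indep l : {set {set E}} := [set A | (nullity A <= l)%N].

Lemma elongation_indep0 l : set0 \in elongation_indep l.
Proof. by rewrite inE /nullity cards0. Qed.

Lemma elongation_indepS l A B :
  A \subset B -> B \in elongation_indep l -> A \in elongation_indep l.
Proof. by rewrite !inE => /nullityS; apply: leq_trans. Qed.

Lemma elongation_indep_aug l A B :
  A \in elongation_indep l -> B \in elongation_indep l -> (#|A| < #|B|)%N ->
  exists2 x, x \in B :\: A & x |: A \in elongation_indep l.
Proof.
rewrite !inE => nA nB lt.
have rA := mrank_le_card A; have rB := mrank_le_card B.
have [ltr | ler] := ltnP (mrank A) (mrank B).
  have [x xBA rx] := mrank_aug ltr; exists x => //.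
  move/setDP: xBA => [_ xA]; have := mrank_le_card (x |: A).
  by move: nA rx; rewrite inE /nullity cardsU1 xA; lia.
have /card_gt0P[x xBA] : (0 < #|B :\: A|)%N.
  by have := cardsD B A; have := subset_leq_card (subsetIr B A); lia.
exists x => //; move/setDP: xBA => [_ xA].
have := mrankS (subsetUr [set x] A).
by move: nA nB; rewrite inE /nullity cardsU1 xA; lia.
Qed.

Definition elongation l : matroid E :=
  Matroid (@elongation_indep0 l) (@elongation_indepS l)
          (@elongation_indep_aug l).

Definition gweight_poly j : {poly int} :=
  if j is 0 then 1 else
  (-1) ^+ j *
    \sum_(s : {set E} | #|s| == j) \sum_(g : {set E} | g \subset s)
      (-1) ^+ #|g| *: 'X^(nullity g).

End Matroids.

(* The ground set is enumerated by enum_rank, so that k[x_1, ..., x_n] is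
   {mpoly k[#|E|]} and e is associated with the variable 'X_(enum_rank e). *)
Definition sr_monomial (k : fieldType) (E : finType) (C : {set E}) :
    {mpoly k[#|E|]} :=
  \prod_(e in C) 'X_(enum_rank e).

Definition sr_ideal (k : fieldType) (E : finType) (N : matroid E)
    (p : {mpoly k[#|E|]}) : Prop :=
  exists c : {set E} -> {mpoly k[#|E|]},
    p = \sum_(C : {set E} | circuit N C) c C * sr_monomial k C.

Section Resolutions.
Variables (k : fieldType) (n : nat).
Local Notation S := {mpoly k[n]}.

(* A finitely generated graded free module S(-d_1) (+) ... (+) S(-d_r) is
   given by the list of its shifts [:: d_1; ...; d_r] (with repetitions); its
   elements are row vectors, and matrices act on the right.  The matrix A is a
   degree-preserving map from the module with shifts c to the one with shifts
   d iff its entry (a, b) is homogeneous of degree c_a - d_b (hence zero when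
   c_a < d_b). *)
Definition graded_mx (c d : seq nat) (A : 'M[S]_(size c, size d)) : Prop :=
  forall a b (m : 'X_{1..n}), m \in msupp (A a b) ->
    (mdeg m + nth 0 d b = nth 0 c a)%N.

(* Minimal graded free resolutions 0 <- I <- F_0 <- F_1 <- ... over S of a
   homogeneous ideal I.  Minimality: F_(i+1) is mapped into (x_1, ..., x_n)F_i,
   that is, all the entries of the differentials have zero constant term. *)
Record min_graded_resolution (I : S -> Prop) := MinGradedResolution {
  shifts : nat -> seq nat;
  augm : 'cV[S]_(size (shifts 0));
  diff : forall i, 'M[S]_(size (shifts i.+1), size (shifts i));
  augm_graded : graded_mx (d := [:: 0%N]) augm;
  diff_graded : forall i, graded_mx (diff i);
  augm_image : forall p, I p <-> exists v : 'rV_(size (shifts 0)),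
    p = (v *m augm) 0 0;
  augm_exact : forall v : 'rV_(size (shifts 0)),
    v *m augm = 0 <-> exists w : 'rV_(size (shifts 1)), v = w *m diff 0;
  diff_exact : forall i (v : 'rV_(size (shifts i.+1))),
    v *m diff i = 0 <->
      exists w : 'rV_(size (shifts i.+2)), v = w *m diff i.+1;
  diff_minimal : forall i a b, (diff i a b)@_0%MM = 0
}.

(* F_i is the direct sum over j of S(-j)^(b i j). *)
Definition is_graded_betti (I : S -> Prop) (b : nat -> nat -> nat) : Prop :=
  exists F : min_graded_resolution I,
    forall i j, b i j = count_mem j (shifts F i).

End Resolutions.

(* Main.v *)
(* Fix a degree d.  Both the alternating Betti numbers
   chi(j) = sum_i (-1)^i beta_(i,j) of I_N and the Moebius sums
   mu(j) = sum_(|A| = j) sum_(B <= A, B dependent) (-1)^(|A| + |B|)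
   satisfy sum_(e <= d) f(e) #{monomials of degree d - e} = dim (I_N)_d:
   for chi, take the degree d part of the resolution; for mu, a monomial of
   degree d - |A| is a monomial of degree d whose support contains A, and
   Moebius inversion over the subsets of the support applies.  The system is
   unitriangular, so chi = mu, and for N = M_l the difference of consecutive
   mu's selects the B of nullity exactly l.  Truncating i at n is harmless for
   j <= n, as minimality forces the shifts of F_i to be at least i. *)
Require Import Defs.
From HB Require Import structures.
From mathcomp Require Import all_boot all_order all_algebra.
From mathcomp Require Import mpoly zify.

Import GRing.Theory.
Local Open Scope ring_scope.
Set Implicit Arguments.
Unset Strict Implicit.
Unset Printing Implicit Defensive.

(** * Degree-[d] pieces of graded free modules as finite-dimensional vector spaces *)

Section DegreePieces.
Variables (k : fieldType) (n d : nat).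
Local Notation S := {mpoly k[n]}.
Implicit Types c : seq nat.

(* Indexes the monomial basis of the degree d piece of (+)_b S(-c_b). *)
Definition strand c :=
  {p : 'I_(size c) * 'X_{1..n < d.+1} | (mdeg p.2 + nth 0 c p.1 == d)%N}.

Definition strand_key c (t : strand c) : 'I_(size c) * 'X_{1..n} :=
  ((val t).1, bmnm (val t).2).

Lemma strand_key_inj c : injective (@strand_key c).
Proof.
move=> [[a m] p] [[b m'] q] [ea em]; apply: val_inj => /=.
by congr pair; last exact: val_inj.
Qed.

Definition of_strand c (u : {ffun strand c -> k^o}) : 'rV[S]_(size c) :=
  \row_b \sum_(t | (val t).1 == b) (u t : k) *: 'X_[(val t).2].

(** The key stays abstract because it is [strand_key] for a free module and [Qd_key] for the
    ideal. *)
Definition coords (T : finType) r (key : T -> 'I_r * 'X_{1..n}) (v : 'rV[S]_r)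
    : {ffun T -> k^o} :=
  [ffun t => (v 0 (key t).1)@_(key t).2].

Lemma of_strand_linear c a (u v : {ffun strand c -> k^o}) :
  of_strand (a *: u + v) = a%:MP *: of_strand u + of_strand v.
Proof.
apply/rowP=> b; rewrite !mxE mulr_sumr -big_split /=.
apply: eq_bigr => t _.
by rewrite !ffunE /= scalerDl -scalerA mul_mpolyC.
Qed.

Lemma coords_linear (T : finType) r (key : T -> 'I_r * 'X_{1..n}) a u v :
  coords key (a%:MP *: u + v) = a *: coords key u + coords key v.
Proof. by apply/ffunP=> t; rewrite !ffunE !mxE mcoeffD mcoeffCM. Qed.

Lemma of_strandK c : cancel (@of_strand c) (coords (@strand_key c)).
Proof.
move=> u; apply/ffunP=> t; rewrite ffunE mxE raddf_sum /= (bigD1 t) //=.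
rewrite mcoeffZ mcoeffX eqxx mulr1 big1 ?addr0 // => s /andP[/eqP e ne].
rewrite mcoeffZ mcoeffX; case: eqP => [e2|_]; last by rewrite mulr0.
by case/eqP: ne; apply: strand_key_inj; congr pair.
Qed.

(** Reading off coordinates and rebuilding is the projection onto the homogeneous component of
    degree [d]. *)
Lemma mcoeff_of_coords c (v : 'rV[S]_(size c)) b m :
  (of_strand (coords (@strand_key c) v) 0 b)@_m =
  if (mdeg m + nth 0 c b == d)%N then (v 0 b)@_m else 0.
Proof.
rewrite mxE raddf_sum /=; case: ifP => [e|ne].
  have lt : (mdeg m < d.+1)%N by rewrite ltnS -(eqP e) leq_addr.
  pose t : strand c := exist _ (b, BMultinom lt) e.
  rewrite (bigD1 t) //= mcoeffZ mcoeffX eqxx mulr1 ffunE /= big1 ?addr0 //.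
  move=> s /andP[/eqP eb ns]; rewrite mcoeffZ mcoeffX.
  case: eqP => [e2|_]; last by rewrite mulr0.
  by case/eqP: ns; apply: strand_key_inj; congr pair.
apply: big1 => s /eqP eb; rewrite mcoeffZ mcoeffX.
case: eqP => [e2|_]; last by rewrite mulr0.
by move: (valP s); rewrite /= eb e2 ne.
Qed.

(** The monomials of the entry [A a b] all have degree [c_a - c'_b], so only the degree-[d]
    component of [v] contributes to degree [d]. *)
Lemma of_coords_mul c c' (A : 'M[S]_(size c, size c')) v : graded_mx A ->
  of_strand (coords (@strand_key c') (v *m A)) =
  of_strand (coords (@strand_key c) v) *m A.
Proof.
move=> gA; apply/rowP=> b; apply/mpolyP=> m; rewrite mcoeff_of_coords !mxE.
rewrite !raddf_sum /= -[if _ then _ else _]mulrb -sumrMnl.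
apply: eq_bigr => a _; rewrite !mcoeffM -sumrMnl; apply: eq_bigr => q /eqP em.
have dm := congr1 (@mdeg n) em; rewrite mdegD in dm.
rewrite (congr1 (fun e => e + nth 0 c' b == d)%N dm) mcoeff_of_coords.
have [->|/= nz] := eqVneq (A a b)@_q.2 0; first by rewrite !mulr0 mul0rn.
have := gA a b q.2; rewrite mcoeff_msupp => /(_ nz) <-.
by rewrite -!addnA; case: ifP => _; rewrite ?mulr1n ?mulr0n ?mul0r.
Qed.

Section Maps.
Variables (T : finType) (c : seq nat) (r : nat) (key : T -> 'I_r * 'X_{1..n}).
Variable A : 'M[S]_(size c, r).

Definition strand_map (u : {ffun strand c -> k^o}) : {ffun T -> k^o} :=
  coords key (of_strand u *m A).

Fact strand_map_is_linear : linear strand_map.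
Proof.
by move=> a u v; rewrite /strand_map of_strand_linear mulmxDl -scalemxAl
  coords_linear.
Qed.

HB.instance Definition _ :=
  GRing.isLinear.Build k {ffun strand c -> k^o} {ffun T -> k^o} _ strand_map
    strand_map_is_linear.

Lemma dim_strand_map :
  (\dim (lker (linfun strand_map)) + \dim (limg (linfun strand_map)))%N
  = #|{: strand c}|.
Proof.
by rewrite -(capfv (lker _)) limg_ker_dim dimvf /dim /= muln1.
Qed.
End Maps.


Lemma of_strand_mul_eq0 c c' (A : 'M[S]_(size c, size c')) u :
  graded_mx A -> strand_map (@strand_key c') A u = 0 -> of_strand u *m A = 0.
Proof.
move=> gA e0; rewrite -[u in LHS]of_strandK -of_coords_mul //.
rewrite [coords _ _]e0; apply/rowP=> b.
by rewrite !mxE big1 // => t _; rewrite ffunE scale0r.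
Qed.

(** A preimage [w] over the polynomial ring can be replaced by its degree-[d] component, so
    exactness restricts to strands. *)
Lemma limg_strand_map_exact (T : finType) c c' r
    (key : T -> 'I_r * 'X_{1..n}) (A : 'M[S]_(size c, size c'))
    (B : 'M[S]_(size c', r)) :
  graded_mx A ->
  (forall u, strand_map key B u = 0 <-> exists w, of_strand u = w *m A) ->
  limg (linfun (strand_map (@strand_key c') A)) = lker (linfun (strand_map key B)).
Proof.
move=> gA ex; apply/vspaceP=> u; rewrite memv_ker lfunE /=.
apply/memv_imgP/eqP => [[w _ ->]|/ex[w e]].
  rewrite lfunE /=; apply/ex; exists (of_strand w).
  by rewrite /strand_map of_coords_mul // of_strandK.
exists (coords (@strand_key c) w); rewrite ?memvf // lfunE /= /strand_map.
by rewrite -of_coords_mul // of_strandK -e of_strandK.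
Qed.

End DegreePieces.

(** * Shifts of a minimal resolution and the Euler characteristic of its degree-[d] part *)

Section Resolution.
Variables (k : fieldType) (n : nat) (I : {mpoly k[n]} -> Prop).
Variable F : min_graded_resolution I.
Local Notation S := {mpoly k[n]}.
Local Notation c := (shifts F).

(* Otherwise a basis vector would be a boundary, against minimality. *)
Lemma diff_row_neq0 i a : exists b, diff F i a b != 0.
Proof.
apply/existsP; apply: contraT => /existsPn h.
have e0 : delta_mx 0 a *m diff F i = 0 :> 'rV[S]_(size (c i)).
  by rewrite -rowE; apply/rowP=> b; rewrite !mxE; apply/eqP; rewrite -[_ == _]negbK.
have [w /rowP/(_ a)] :
    exists w, delta_mx 0 a = w *m diff F i.+1 :> 'rV[S]_(size (c i.+1)).
  by case: i a h e0 => [|i] a h /diff_exact.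
rewrite !mxE !eqxx => /(congr1 (mcoeff 0%MM)); rewrite mcoeff1 eqxx raddf_sum /=.
rewrite big1 => [/eqP|b _]; first by rewrite oner_eq0.
by rewrite rmorphM /= diff_minimal mulr0.
Qed.

(** By minimality a nonzero entry of a differential has positive degree, so each shift of F_(i+1)
    exceeds some shift of F_i. *)
Lemma leq_shifts i a : (a < size (c i))%N -> (i <= nth 0 (c i) a)%N.
Proof.
elim: i a => // i IH a lt; have [b nz] := diff_row_neq0 (Ordinal lt).
have := diff_graded (mlead_supp nz); rewrite /= => <-.
have pos : (0 < mdeg (mlead (diff F i (Ordinal lt) b)))%N.
  rewrite lt0n mdeg_eq0; apply: contraNneq nz => e.
  by rewrite -mleadc_eq0 e diff_minimal.
by have := IH b (ltn_ord b); lia.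
Qed.

Section Euler.
Variables (d : nat) (Q : pred 'X_{1..n}).
Hypothesis IQ : forall p m, I p -> m \in msupp p -> Q m.
Hypothesis QI : forall m, Q m -> I 'X_[m].
Local Notation Qd := {m : 'X_{1..n < d.+1} | (mdeg m == d) && Q m}.

(** By [IQ] and [QI], the monomials in [Qd] form a basis of the degree-[d] part of [I]; with this
    target the augmentation becomes surjective. *)
Definition Qd_key (m : Qd) : 'I_1 * 'X_{1..n} := (0, bmnm (val m)).

Local Notation strand_aug := (@strand_map k n d _ _ _ Qd_key (augm F)).
Local Notation strand_diff i :=
  (@strand_map k n d _ _ _ (@strand_key n d _) (diff F i)).

(** The image lies in [I], so by [IQ] its coefficients outside [Q] vanish anyway and the [Qd]
    coordinates detect it completely. *)
Lemma strand_map_augm_eq0 (u : {ffun strand n d (c 0) -> k^o}) :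
  strand_aug u = 0 <->
  exists w, of_strand u = w *m diff F 0 :> 'rV_(size (c 0)).
Proof.
split=> [e0|/augm_exact e]; last first.
  by apply/ffunP=> m; rewrite !ffunE e mxE mcoeff0.
(* The polynomial ring is treated as the free module with the single shift 0. *)
apply/augm_exact/(@of_strand_mul_eq0 _ _ d _ [:: 0%N]); first exact: augm_graded.
apply/ffunP=> t; rewrite [LHS]ffunE [RHS]ffunE /= (ord1 (val t).1).
apply/eqP; rewrite mcoeff_eq0; apply/negP=> tp.
have Qt : Q (val t).2 by apply: IQ tp; apply/augm_image; exists (of_strand u).
have dt : mdeg (val t).2 == d by have := valP t; rewrite /= (ord1 (val t).1) addn0.
have Pt : (mdeg (val t).2 == d) && Q (val t).2 by rewrite dt.
move/ffunP/(_ (exist _ (val t).2 Pt)): e0; rewrite !ffunE /= => /eqP.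
by rewrite mcoeff_eq0 tp.
Qed.

Lemma strand_map_augm_surj (g : {ffun Qd -> k^o}) :
  exists u : {ffun strand n d (c 0) -> k^o}, strand_aug u = g.
Proof.
(* Any [v] with the right [Qd] coordinates will do, since its degree-[d] component has the same
   ones. *)
suff [v ev] : exists v : 'rV_(size (c 0)), coords Qd_key (v *m augm F) = g.
  exists (coords (@strand_key _ _ _) v); rewrite -ev /strand_map.
  rewrite -(@of_coords_mul _ _ d _ [:: 0%N]); last exact: augm_graded.
  apply/ffunP=> t; rewrite !ffunE /= (@mcoeff_of_coords _ _ _ [:: 0%N]) /=.
  by case/andP: (valP t) => /eqP-> _; rewrite addn0 eqxx.
have QX (t : Qd) : exists v : 'rV_(size (c 0)), 'X_[val t] = (v *m augm F) 0 0.
  by apply/augm_image/QI; case/andP: (valP t).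
have [v ev] := fin_all_exists QX.
exists (\sum_t ((g t : k)%:MP *: v t)).
apply/ffunP=> t; rewrite ffunE mulmx_suml summxE raddf_sum (bigD1 t) //=.
rewrite -scalemxAl mxE -ev mcoeffCM mcoeffX eqxx mulr1 big1 ?addr0 // => s ne.
rewrite -scalemxAl mxE -ev mcoeffCM mcoeffX.
case: eqP => [e|_]; last by rewrite mulr0.
by case/eqP: ne; do 2 apply: val_inj.
Qed.

Lemma card_strand0 :
  #|{: strand n d (c 0)}| =
  (#|{: Qd}| + \dim (limg (linfun (strand_diff 0))))%N.
Proof.
rewrite -(@dim_strand_map k n d _ _ _ Qd_key (augm F)) addnC; congr addn.
  suff -> : limg (linfun strand_aug) = fullv.
    by rewrite dimvf /dim /= muln1.
  apply/vspaceP=> g; rewrite memvf; have [u <-] := strand_map_augm_surj g.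
  by apply/memv_imgP; exists u; rewrite ?memvf // lfunE.
congr (\dim _); apply/esym/limg_strand_map_exact; first exact: diff_graded.
exact: strand_map_augm_eq0.
Qed.

Lemma card_strandS i :
  #|{: strand n d (c i.+1)}| =
  (\dim (limg (linfun (strand_diff i))) +
   \dim (limg (linfun (strand_diff i.+1))))%N.
Proof.
rewrite -(@dim_strand_map k n d _ _ _ (@strand_key n d _) (diff F i)) addnC.
congr addn.
congr (\dim _); apply/esym/limg_strand_map_exact; first exact: diff_graded.
move=> u; rewrite -diff_exact; split=> [e|e].
  exact: of_strand_mul_eq0 (@diff_graded _ _ _ F i) e.
by apply/ffunP=> t; rewrite !ffunE e mxE mcoeff0.
Qed.

Lemma card_strand_gt i : (d < i)%N -> #|{: strand n d (c i)}| = 0%N.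
Proof.
move=> lt; apply: eq_card0 => -[[a m] p]; move/eqP: (p) => /= e.
by have := leq_shifts (ltn_ord a); lia.
Qed.

Lemma euler_strand N : (d <= N)%N ->
  \sum_(0 <= i < N.+1) (-1) ^+ i * (#|{: strand n d (c i)}|%:Z) = #|{: Qd}|%:Z.
Proof.
move=> leN; pose r i :=
  \dim (limg (linfun (strand_diff i))).
(* Rank-nullity telescopes the sum, leaving the rank [r N] of the differential out of F_(N+1). For d
   <= N that module has no degree-[d] part, so [r N] is 0. *)
suff -> : forall N, \sum_(0 <= i < N.+1) (-1) ^+ i * (#|{: strand n d (c i)}|%:Z)
   = #|{: Qd}|%:Z + (-1) ^+ N * (r N)%:Z.
  have := card_strandS N; rewrite card_strand_gt // -/(r N) => e.
  by rewrite (_ : r N = 0%N) ?mulr0 ?addr0 //; lia.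
elim=> [|N' IH]; first by rewrite big_nat1 card_strand0 PoszD expr0 !mul1r.
rewrite big_nat_recr //= IH card_strandS -/(r N') -/(r N'.+1) PoszD exprS.
by rewrite mulN1r !mulNr mulrDr opprD addrA addrK.
Qed.

End Euler.

End Resolution.

(** * Monomial counts, supports and Moebius inversion *)

Section Counting.

(** This is the Hilbert function of S(-e) at [d]; the additive form gives 0 for e > d, where [d - e]
    would truncate. *)
Definition monom_count n d e := #|[set m : 'X_{1..n < d.+1} | (mdeg m + e == d)%N]|.

Lemma monom_count_diag n d : monom_count n d d = 1%N.
Proof.
apply/eqP/cards1P; have lt : (mdeg (0%MM : 'X_{1..n}) < d.+1)%N by rewrite mdeg0.
exists (BMultinom lt); apply/setP=> m; rewrite !inE.
rewrite -[X in (_ == X)%N]add0n eqn_add2r.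
by rewrite mdeg_eq0; apply/eqP/eqP => [e|->//]; apply: val_inj.
Qed.

Lemma monom_count_gt n d e : (d < e)%N -> monom_count n d e = 0%N.
Proof.
by move=> lt; apply/eqP; rewrite cards_eq0; apply/eqP/setP=> m; rewrite !inE; lia.
Qed.

Lemma card_strand n d c :
  #|{: strand n d c}| = (\sum_(0 <= e < d.+1) count_mem e c * monom_count n d e)%N.
Proof.
transitivity (\sum_(e <- c) monom_count n d e)%N.
  rewrite (big_nth 0%N) big_mkord card_sub.
  rewrite -sum1_card (eq_bigl (fun p : 'I_(size c) * 'X_{1..n < d.+1} =>
    true && (mdeg p.2 + nth 0 c p.1 == d)%N)) //.
  rewrite -(pair_big_dep xpredT (fun (a : 'I_(size c)) (m : 'X_{1..n < d.+1}) =>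
    (mdeg m + nth 0 c a == d)%N) (fun _ _ => 1%N)) /=.
  by apply: eq_bigr => a _; rewrite sum1_card /monom_count cardsE.
elim: c => [|x c IH]; first by rewrite big_nil big1.
rewrite big_cons IH /=; under [RHS]eq_bigr do rewrite mulnDl.
rewrite big_split /=; congr addn.
rewrite big_mkord; have [lt|gt] := ltnP d x.
  rewrite monom_count_gt // big1 // => i _.
  by case: eqP => // e; have := ltn_ord i; lia.
rewrite (bigD1 (Ordinal (n := d.+1) (m := x) gt)) //= eqxx mul1n big1 ?addn0 //.
by move=> i ne; case: eqP => // e; case/eqP: ne; apply: val_inj.
Qed.

(** The system is triangular with diagonal entries 1, so strong induction cancels all terms but the
    last. *)
Lemma monom_count_inj n (f g : nat -> int) N :
  (forall d, (d <= N)%N ->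
     \sum_(0 <= e < d.+1) f e * (monom_count n d e)%:Z =
     \sum_(0 <= e < d.+1) g e * (monom_count n d e)%:Z) ->
  forall e, (e <= N)%N -> f e = g e.
Proof.
move=> fg; elim/ltn_ind => e IH le; have := fg e le.
rewrite !big_nat_recr //= monom_count_diag !mulr1.
rewrite (eq_big_nat _ _ (F2 := fun x => g x * (monom_count n e x)%:Z)).
  exact: addrI.
by move=> i /andP[_ lt]; rewrite IH //; lia.
Qed.

Variable E : finType.
Implicit Types (A B C : {set E}) (D : pred {set E}).

(** For A properly inside B, toggling a fixed x in B but not in A is a sign-reversing involution of
    the interval. *)
Lemma sum_sign_interval A B :
  \sum_(C : {set E} | (A \subset C) && (C \subset B)) (-1) ^+ #|C| =
  if A == B then (-1) ^+ #|A| else 0 :> int.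
Proof.
case: eqP => [<-|/eqP ne].
  by rewrite (big_pred1 A) // => C; rewrite /= eqEsubset andbC.
have [sAB|nsAB] := boolP (A \subset B); last first.
  rewrite big_pred0 // => C; apply/negP=> /andP[sAC sCB].
  by case/negP: nsAB; apply: subset_trans sAC sCB.
have /properP[_ [x xB xA]] : A \proper B by rewrite properEneq ne.
pose t C := if x \in C then C :\ x else x |: C.
have tK : involutive t.
  move=> C; rewrite /t; have [xC|xC] := boolP (x \in C); rewrite !inE eqxx /=.
    exact: setD1K.
  exact: setU1K.
suff e : forall s : int, s = - s -> s = 0.
  apply: e; rewrite [LHS](reindex_inj (inv_inj tK)) -sumrN /=.
  apply: eq_big => C; rewrite /t; case: ifP => xC.
  - by rewrite subsetD1 xA andbT subDset (setUidPr _) ?sub1set.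
  - rewrite subUset sub1set xB; congr (_ && _).
    by rewrite -{2}(setU1K (negbT xC)) subsetD1 xA andbT.
  - by rewrite [in RHS](cardsD1 x) xC exprS mulN1r opprK.
  - by rewrite cardsU1 xC exprS mulN1r.
by move=> s; lia.
Qed.

Definition mobius_sum D j : int :=
  \sum_(A : {set E} | #|A| == j) \sum_(B : {set E} | B \subset A)
    (-1) ^+ (#|A| + #|B|) * (D B)%:Z.

Definition supp (m : 'X_{1..#|E|}) : {set E} := [set e | m (enum_rank e) != 0%N].

Definition set_monom A : 'X_{1..#|E|} :=
  [multinom (enum_val i \in A : nat) | i < #|E|].

Lemma set_monom_rank A e : set_monom A (enum_rank e) = (e \in A) :> nat.
Proof. by rewrite mnmE enum_rankK. Qed.

Lemma set_monom_le A m : (set_monom A <= m)%MM = (A \subset supp m).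
Proof.
apply/mnm_lepP/subsetP => [h e eA|h i].
  by have := h (enum_rank e); rewrite set_monom_rank eA inE lt0n.
rewrite mnmE; case: (boolP (_ \in A)) => //= /h.
by rewrite inE enum_valK lt0n.
Qed.

Lemma mdeg_set_monom A : mdeg (set_monom A) = #|A|.
Proof.
rewrite mdegE (reindex _ (onW_bij _ (@enum_rank_bij E))) /=.
under eq_bigr do rewrite set_monom_rank.
by rewrite -sum1_card [RHS]big_mkcond; apply: eq_bigr => e _; case: (e \in A).
Qed.

(** Dividing by the squarefree monomial of [A] is a bijection from the monomials whose support
    contains [A]. *)
Lemma monom_count_supp d A :
  monom_count #|E| d #|A| =
  #|[set m : 'X_{1..#|E| < d.+1} | (mdeg m == d) && (A \subset supp m)]|.
Proof.
have lt (m : 'X_{1..#|E| < d.+1}) : (mdeg (m - set_monom A)%MM < d.+1)%N.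
  apply: leq_ltn_trans (bmdeg m).
  by rewrite !mdegE leq_sum // => i _; rewrite mnmBE leq_subr.
have injf : {in [set m : 'X_{1..#|E| < d.+1} |
      (mdeg m == d) && (A \subset supp m)] &,
    injective (fun m => BMultinom (lt m))}.
  move=> m m'; rewrite !inE -!set_monom_le => /andP[_ le] /andP[_ le'].
  move=> /(congr1 val) /= e.
  by apply: val_inj; rewrite /= -(submK le) -(submK le') e.
rewrite -(card_in_imset injf); congr #|pred_of_set _|; apply/setP=> m.
apply/idP/imsetP => [|[m' + ->]]; rewrite !inE /=.
  move=> /eqP e.
  have lt' : (mdeg (m + set_monom A)%MM < d.+1)%N by rewrite mdegD mdeg_set_monom e.
  exists (BMultinom lt'); last by apply: val_inj; rewrite /= addmK.
  by rewrite inE /= mdegD mdeg_set_monom e eqxx -set_monom_le lem_addl.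
case/andP=> /eqP e; rewrite -set_monom_le => le.
by rewrite -mdeg_set_monom -mdegD submK // e.
Qed.

Lemma mobius_sum_conv D d :
  \sum_(0 <= j < d.+1) mobius_sum D j * (monom_count #|E| d j)%:Z =
  #|[set m : 'X_{1..#|E| < d.+1} | (mdeg m == d) && D (supp m)]|%:Z.
Proof.
pose mu A : int := \sum_(B : {set E} | B \subset A) (-1) ^+ (#|A| + #|B|) * (D B)%:Z.
transitivity (\sum_A mu A * (monom_count #|E| d #|A|)%:Z).
  (* Sets with more than [d] elements have monomial count 0; on the remaining ones [inord] preserves
     the size. *)
  rewrite (bigID (fun A => #|A| < d.+1)%N) /= [X in _ + X]big1 ?addr0; last first.
    by move=> A gt; rewrite monom_count_gt ?mulr0 //; lia.
  rewrite big_mkord (partition_big (fun A => inord #|A| : 'I_d.+1) xpredT) //=.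
  apply: eq_bigr => j _; rewrite mulr_suml; apply: eq_big => [A|A /eqP <- //].
  apply/eqP/andP => [->|[lt /eqP <-]]; last by rewrite inordK.
  by rewrite ltn_ord; split=> //; apply/eqP/val_inj; rewrite /= inordK.
(* Double counting of the pairs of a monomial [m] and a set [A] inside its support. *)
transitivity (\sum_(m : 'X_{1..#|E| < d.+1} | mdeg m == d)
   \sum_(A : {set E} | A \subset supp m) mu A).
  rewrite (exchange_big_dep xpredT) //=; apply: eq_bigr => A _.
  by rewrite monom_count_supp sumr_const cardsE -mulr_natr natz.
rewrite -sum1_card; rewrite -natz natr_sum /=.
rewrite [RHS](eq_bigl (fun m : 'X_{1..#|E| < d.+1} =>
    (mdeg m == d) && D (supp m))); last first.
  by move=> m; rewrite inE.
rewrite [RHS]big_mkcondr /=; apply: eq_bigr => m _.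
rewrite (exchange_big_dep (fun B : {set E} => B \subset supp m)) /=; last first.
  by move=> A B sA sB; apply: subset_trans sB sA.
(* With [B] outermost, the signs of the [A] between [B] and [supp m] cancel unless [B] is the whole
   support. *)
transitivity (\sum_(B : {set E} | B \subset supp m) (-1) ^+ #|B| * (D B)%:Z *
   (if B == supp m then (-1) ^+ #|B| else 0) : int).
  apply: eq_bigr => B _; rewrite -sum_sign_interval mulr_sumr.
  apply: eq_big => [A|A _]; first by rewrite andbC.
  by rewrite exprD -mulrA mulrC.
rewrite (bigD1 (supp m)) //= eqxx big1 ?addr0; last first.
  by move=> B /andP[_ /negPf->]; rewrite mulr0.
by rewrite mulrAC -exprD addnn -signr_odd odd_double mul1r; case: (D _).
Qed.

End Counting.

(** * Monomials of the Stanley-Reisner ideal and its alternating Betti sums *)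

Section StanleyReisner.
Variables (k : fieldType) (E : finType).

Lemma sr_monomialE (C : {set E}) : sr_monomial k C = 'X_[set_monom C].
Proof.
rewrite /sr_monomial mprodXE; congr 'X_[_]; apply/mnmP=> i.
rewrite mnm_sumE mnmE big_mkcond (bigD1 (enum_val i)) //= big1 => [|e ne].
  by rewrite mnm1E enum_valK eqxx addn0; case: (_ \in C).
case: ifP => // _; rewrite mnm1E; case: eqP => // e'.
by case/eqP: ne; rewrite -e' enum_rankK.
Qed.

(** Such a monomial comes from a multiple of some circuit monomial, so its support contains that
    circuit. *)
Lemma sr_ideal_supp (N : matroid E) (p : {mpoly k[#|E|]}) m :
  sr_ideal N p -> m \in msupp p -> supp m \notin indep N.
Proof.
case=> a ->; rewrite mcoeff_msupp raddf_sum /= => nz.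
have [C cC aC] : exists2 C, circuit N C & (a C * sr_monomial k C)@_m != 0.
  apply/exists_inP; apply: contraNT nz => /exists_inPn h.
  by rewrite big1 // => C /h /negPn/eqP.
have sC : C \subset supp m.
  rewrite -set_monom_le; move: aC; rewrite sr_monomialE -mcoeff_msupp.
  by rewrite (perm_mem (msuppMX _ _)) => /mapP[m' _ ->]; apply: lem_addr.
by apply: contra (minsetp cC); apply: indepS.
Qed.

(** A dependent support contains a circuit, whose monomial divides ['X_[m]]. *)
Lemma sr_ideal_monomial (N : matroid E) m :
  supp m \notin indep N -> sr_ideal N ('X_[m] : {mpoly k[#|E|]}).
Proof.
move=> dep; have [C cC sC] := minset_exists (P := fun A => A \notin indep N) dep.
exists (fun B => if B == C then 'X_[m - set_monom C] else 0).
rewrite (bigD1 C) //= eqxx big1 ?addr0 => [|B /andP[_ /negPf->]]; last exact: mul0r.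
by rewrite sr_monomialE -mpolyXD submK // set_monom_le.
Qed.

Lemma alternating_betti (N : matroid E) (b : nat -> nat -> nat) j :
  is_graded_betti (@sr_ideal k E N) b -> (j <= #|E|)%N ->
  \sum_(0 <= i < #|E|.+1) (-1) ^+ i * (b i j)%:Z =
  mobius_sum (fun A => A \notin indep N) j.
Proof.
case=> F bF; move: j; apply: (@monom_count_inj #|E|) => d le.
rewrite mobius_sum_conv.
(* Degrees d <= |E| determine the values at j <= |E|, and for them the sum over i <= |E| already
   covers every nonzero strand. *)
have := euler_strand (Q := fun m => supp m \notin indep N) F
  (@sr_ideal_supp N) (@sr_ideal_monomial N) le.
rewrite card_sub cardsE => <-.
under eq_bigr do rewrite mulr_suml.
rewrite exchange_big /=; apply: eq_bigr => i _.
rewrite card_strand -natz natr_sum mulr_sumr; apply: eq_bigr => e _.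
by rewrite bF -mulrA natz PoszM.
Qed.

End StanleyReisner.

(** * Weight polynomial coefficients as differences of Moebius sums, and the conclusion *)

Lemma mobius_sum_pred0 (E : finType) (D : pred {set E}) j :
  D =1 pred0 -> mobius_sum D j = 0.
Proof. by move=> D0; apply: big1 => A _; apply: big1 => B _; rewrite D0 mulr0. Qed.

Lemma mobius_sum_predT (E : finType) (D : pred {set E}) j :
  D =1 predT -> (0 < j)%N -> mobius_sum D j = 0.
Proof.
move=> DT j0; apply: big1 => A /eqP cA.
transitivity ((-1) ^+ #|A| *
    \sum_(B : {set E} | (set0 \subset B) && (B \subset A)) (-1) ^+ #|B| : int).
  by rewrite mulr_sumr; apply: eq_big => B; rewrite ?sub0set // DT mulr1 exprD.
rewrite sum_sign_interval; case: eqP => [e|_]; last by rewrite mulr0.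
by move: j0; rewrite -cA -e cards0.
Qed.

(** The indicator of nullity exactly [l] is the difference of the indicators of nullity at least [l]
    and above [l]. *)
Lemma coef_gweight_poly (E : finType) (M : matroid E) j l : (0 < j)%N ->
  (gweight_poly M j)`_l =
  mobius_sum (fun A => (l <= nullity M A)%N) j -
  mobius_sum (fun A => (l < nullity M A)%N) j.
Proof.
case: j => // j _; rewrite /gweight_poly /mobius_sum -sumrB mulr_sumr coef_sum.
apply: eq_bigr => A /eqP cA; rewrite -sumrB mulr_sumr coef_sum.
apply: eq_bigr => B _.
rewrite -mulrBr cA exprD -mulrA -polyC1 -polyCN -polyC_exp coefCM coefZ coefXn.
by congr (_ * (_ * _)); case: ltngtP.
Qed.

Theorem theorem5 (E : finType) (M : matroid E) (k : fieldType)
    (beta : int -> nat -> nat -> nat)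
    (beta_in : forall l : nat, (l <= #|E| - mrank M [set: E])%N ->
       is_graded_betti (@sr_ideal k E (elongation M l)) (beta l%:Z))
    (beta_out : forall l : int,
       ~~ (0 <= l <= (#|E| - mrank M [set: E])%N%:Z) ->
       forall i j, beta l i j = 0%N)
    (j : nat) (hj : (1 <= j <= #|E|)%N) (l : nat) :
  (gweight_poly M j)`_l =
    \sum_(0 <= i < #|E|.+1)
      (-1) ^+ i * ((beta (l%:Z - 1) i j)%:Z - (beta l%:Z i j)%:Z).
Proof.
case/andP: hj => j0 jn.
have chi (l' : nat) : \sum_(0 <= i < #|E|.+1) (-1) ^+ i * (beta l' i j)%:Z =
    mobius_sum (fun A => (l' < nullity M A)%N) j.
  (* In range, dependence in the elongation means nullity above [l']; beyond it no set has such
     nullity, and both sides are 0. *)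
  have [le|gt] := leqP l' (#|E| - mrank M [set: E]).
    rewrite (alternating_betti (beta_in l' le) jn).
    by apply: eq_bigr => A _; apply: eq_bigr => B _; rewrite inE ltnNge.
  rewrite mobius_sum_pred0 => [|A]; last first.
    apply/negbTE; rewrite -leqNgt; apply: leq_trans (nullityS M (subsetT A)) _.
    by rewrite /nullity cardsT ltnW.
  by rewrite big1 // => i _; rewrite beta_out ?mulr0 //; lia.
rewrite coef_gweight_poly //; under eq_bigr do rewrite mulrBr.
rewrite sumrB chi; congr (_ - _).
(* For l = 0 the index -1 is out of range, and the matching Moebius sum runs over all subsets, hence
   vanishes as j > 0. *)
case: l => [|l].
  rewrite mobius_sum_predT // big1 // => i _.
  by rewrite beta_out ?mulr0 //; lia.
have -> : l.+1%:Z - 1 = l%:Z by lia.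
by rewrite chi.
Qed.
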